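(* For each integer $k\in\{0,1,2,3,4\}$, the only double-$\mathrm{col}$-critical graph with colouring number $k$ is the complete graph $K_k$ on $k$ vertices (up to isomorphism).
   Context: All graphs are finite and simple. The colouring number $\mathrm{col}(G)$ of a non-empty graph $G$ is the smallest integer $k$ for which there is an ordering of the vertices of $G$ such that, when removing the vertices in this order, no vertex of degree more than $k-1$ in the remaining graph is removed at any step; equivalently $\mathrm{col}(G)=\max\{\delta(H) : H \text{ is a (non-empty) induced subgraph of } G\}+1$. The empty graph $K_0$ has colouring number $0$. For an edge $e=xy$ let $V(e)=\{x,y\}$. An edge $e$ of $G$ is double-$\mathrm{col}$-critical if $\mathrm{col}(G-V(e))\le \mathrm{col}(G)-2$. A graph $G$ is double-$\mathrm{col}$-critical if it is connected and each of its edges is double-$\mathrm{col}$-critical. The empty graph $K_0$ is regarded as connected, so $K_0$ and $K_1$ are (vacuously) double-$\mathrm{col}$-critical. *)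

(* Defs.v *)
From mathcomp Require Import all_boot.

Set Implicit Arguments.
Unset Strict Implicit.
Unset Printing Implicit Defensive.

Record sgraph := SGraph {
  svertex :> finType;
  sedge : rel svertex;
  sedge_sym : symmetric sedge;
  sedge_irrefl : irreflexive sedge }.

Notation "x -- y" := (sedge x y) (at level 30, no associativity).

Definition sgraph_iso (G H : sgraph) : Prop :=
  exists2 f : G -> H, bijective f & forall x y : G, (f x -- f y) = (x -- y).

Section CompleteGraph.
Variable n : nat.

Definition complete_edge : rel 'I_n := fun i j => i != j.

Lemma complete_edge_sym : symmetric complete_edge.
Proof. by move=> i j; rewrite /complete_edge eq_sym. Qed.

Lemma complete_edge_irrefl : irreflexive complete_edge.
Proof. by move=> i; rewrite /complete_edge eqxx. Qed.

Definition complete_graph : sgraph :=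
  SGraph complete_edge_sym complete_edge_irrefl.
End CompleteGraph.

Section Induced.
Variables (G : sgraph) (A : {set G}).

Definition induced_edge : rel {x : G | x \in A} := fun x y => val x -- val y.

Lemma induced_edge_sym : symmetric induced_edge.
Proof. by move=> x y; apply: sedge_sym. Qed.

Lemma induced_edge_irrefl : irreflexive induced_edge.
Proof. by move=> x; apply: sedge_irrefl. Qed.

Definition induced : sgraph := SGraph induced_edge_sym induced_edge_irrefl.
End Induced.

(* G - V(xy) *)
Definition del_ends (G : sgraph) (x y : G) : sgraph := induced (~: [set x; y]).

(* The empty graph is connected. *)
Definition sgraph_connected (G : sgraph) : Prop :=
  forall x y : G, connect (@sedge G) x y.

Section ColouringNumber.
Variable G : sgraph.

(* Degree of x in the subgraph of G induced by A (for x in A). *)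
Definition degree_in (A : {set G}) (x : G) : nat := #|[set y in A | x -- y]|.

(* Just before x is removed, the remaining vertices are those of x :: s'.
   The bound "at most k - 1" is written "< k", so that it is not affected by
   truncated subtraction at k = 0. *)
Fixpoint removable (k : nat) (s : seq G) : bool :=
  if s is x :: s' then
    (degree_in [set y in x :: s'] x < k) && removable k s'
  else true.

Definition has_removal_order (k : nat) : bool :=
  [exists s : #|G|.-tuple G, perm_eq s (enum G) && removable k s].

Lemma ex_removal_order : exists k, has_removal_order k.
Proof.
exists #|G|.+1; apply/existsP; exists (enum_tuple G); rewrite perm_refl /=.
by elim: (enum G) => //= x s ->; rewrite andbT ltnS max_card.
Qed.

(* For the graph with no vertices the empty ordering is allowed for k = 0, so
   its colouring number is 0, as it should be. *)
Definition col : nat := ex_minn ex_removal_order.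
End ColouringNumber.

(* col (G - V(xy)) <= col G - 2, as an inequality between integers *)
Definition double_col_critical_edge (G : sgraph) (x y : G) : Prop :=
  col (del_ends x y) + 2 <= col G.

Definition double_col_critical (G : sgraph) : Prop :=
  sgraph_connected G /\
  forall x y : G, x -- y -> double_col_critical_edge x y.

(* Main.v *)
Require Import Defs.
From mathcomp Require Import all_boot.

(** Write [k] for [col G].  By [col_leE], [col G <= m] means that every
nonempty vertex set [B] has a vertex with fewer than [m] neighbours in [B].

In a double-critical graph, a nonempty set [A] in which every vertex has at
least [k - 1] neighbours in [A] is the whole of [G] ([full_core]): otherwise
connectivity gives an edge leaving [A], and deleting its ends takes only one
vertex from [A], so that the colouring number drops by at most one.  For [k > 0],
[col_leE] with [m = k - 1] provides such a set, so [G] has minimum degree at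
least [k - 1] ([min_degree]).  Moreover a complete subgraph on at least [k]
vertices is all of [G].

Let [a] be a vertex of degree at most [k - 1].  For a neighbour [b] of [a], the
graph left after deleting [a] and [b] has colouring number at most [k - 2], and
[k - 2 <= 2] makes it empty, edgeless or a forest, so it has at least [k - 2]
vertices with fewer than [k - 2] remaining neighbours ([small_degree_count]).  By
the minimum degree these are adjacent to both [a] and [b].  As [a] has at most
[k - 2] neighbours other than [b], they are all adjacent to [b].  Hence [a] and
its neighbours form a complete graph; it has at least [k] vertices by the minimum
degree, and at most [k] by the choice of [a]. *)

Set Implicit Arguments.
Unset Strict Implicit.
Unset Printing Implicit Defensive.

(** * Degrees inside a vertex set *)

Section Degrees.
Variable G : sgraph.
Implicit Types (A B : {set G}) (x y : G).

Lemma sedge_neq x y : x -- y -> x != y.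
Proof. by apply: contraTneq => ->; rewrite sedge_irrefl. Qed.

Lemma degree_inS A B x : A \subset B -> degree_in A x <= degree_in B x.
Proof.
move=> sAB; apply/subset_leq_card/subsetP=> y; rewrite !inE.
by case/andP=> /(subsetP sAB) -> ->.
Qed.

Lemma degree_in_lt_card A x : x \in A -> degree_in A x < #|A|.
Proof.
move=> xA; rewrite (cardsD1 x A) xA ltnS.
apply/subset_leq_card/subsetP=> y; rewrite !inE => /andP[-> /sedge_neq].
by rewrite eq_sym => ->.
Qed.

Lemma degree_inD1 A x y : y \in A ->
  degree_in A x = (x -- y) + degree_in (A :\ y) x.
Proof.
move=> yA; rewrite /degree_in (cardsD1 y) inE yA /=; congr (_ + _).
by apply: eq_card => z; rewrite !inE andbA.
Qed.

Lemma degree_in_complete A x : x \in A ->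
  {in A, forall y, y != x -> x -- y} -> (degree_in A x).+1 = #|A|.
Proof.
move=> xA Ax; rewrite (cardsD1 x A) xA add1n; congr _.+1.
apply: eq_card => y; rewrite !inE.
have [->|yx] := eqVneq y x; first by rewrite sedge_irrefl andbF.
by case yA: (y \in A); rewrite //= Ax.
Qed.

(** * Colouring number and degeneracy *)

(** The classical degeneracy condition; it holds for [A] exactly when the
subgraph induced by [A] has colouring number at most [k], and stating it inside
[G] avoids handling nested subtypes. *)
Definition degenerate k A :=
  [forall B : {set G}, (B \subset A) && (B != set0) ==>
    [exists x in B, degree_in B x < k]].

Lemma degenerateP k A :
  reflect (forall B, B \subset A -> B != set0 ->
             exists2 x, x \in B & degree_in B x < k)
          (degenerate k A).
Proof.
apply: (iffP forallP) => [dA B sBA nzB | dA B].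
  by move: (dA B); rewrite sBA nzB => /exists_inP.
by apply/implyP=> /andP[sBA nzB]; apply/exists_inP/dA.
Qed.

Lemma degenerateS k A B : A \subset B -> degenerate k B -> degenerate k A.
Proof.
move=> sAB /degenerateP dB; apply/degenerateP=> C sCA.
exact/dB/(subset_trans sCA).
Qed.

Lemma removable_leq k l (s : seq G) : k <= l -> removable k s -> removable l s.
Proof.
move=> lekl; elim: s => //= x s IHs /andP[dx /IHs ->]; rewrite andbT.
exact: leq_trans dx lekl.
Qed.

(** The first vertex of [B] to be removed still has all of [B] around it. *)
Lemma removable_degenerate k (s : seq G) :
  removable k s -> degenerate k [set x in s].
Proof.
elim: s => [_ | x s IHs /= /andP[dx /IHs/degenerateP ds]].
  apply/degenerateP=> B sB0 /set0Pn[x /(subsetP sB0)]; by rewrite inE.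
apply/degenerateP=> B sB nzB; have [xB | xB] := boolP (x \in B).
  by exists x => //; apply: leq_ltn_trans (degree_inS _ sB) dx.
apply: ds => //; apply/subsetP=> y yB; move: (subsetP sB y yB).
by rewrite !inE => /orP[/eqP yx | //]; rewrite -yx yB in xB.
Qed.

Lemma degenerate_removable k A : degenerate k A ->
  exists s : seq G, [/\ uniq s, s =i A & removable k s].
Proof.
have [n] := ubnP #|A|; elim: n A => // n IHn A leAn dA.
have [->|nzA] := eqVneq A set0; first by exists [::]; split=> // x; rewrite !inE.
have [x xA dx] := degenerateP _ _ dA A (subxx A) nzA.
have [||s [Us sA rs]] := IHn (A :\ x).
- by move: leAn; rewrite (cardsD1 x A) xA.
- exact: degenerateS (subsetDl _ _) dA.
have xsA : x :: s =i A.
  by move=> y; rewrite inE sA !inE; have [->|] := eqVneq y x.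
exists (x :: s); split=> //=; first by rewrite sA !inE eqxx.
suff -> : [set y in x :: s] = A by rewrite dx.
by apply/setP=> y; rewrite inE xsA.
Qed.

Lemma col_leE k : (col G <= k) = degenerate k [set: G].
Proof.
rewrite /col; case: ex_minnP => m /existsP[s /andP[sG rs]] minm.
apply/idP/idP=> [lemk | /degenerate_removable[t [Ut tG rt]]].
  have := removable_degenerate (removable_leq lemk rs).
  by apply: degenerateS; apply/subsetP=> x _; rewrite inE (perm_mem sG) mem_enum.
have tE : perm_eq t (enum G).
  by apply: uniq_perm => // [|x]; rewrite ?enum_uniq // tG mem_enum inE.
apply: minm; have sz : size t == #|G| by rewrite (perm_size tE) -cardE.
by apply/existsP; exists (Tuple sz); rewrite tE.
Qed.

Lemma col_le_card : col G <= #|G|.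
Proof.
rewrite col_leE; apply/degenerateP=> B _ /set0Pn[x xB]; exists x => //.
exact: leq_trans (degree_in_lt_card xB) (max_card _).
Qed.

(** For [k = 2] this says that a forest with at least two vertices has at least
two vertices of degree at most one.  The induction deletes a vertex [x] of degree
below [k]: at most [k - 1] of the [k] vertices found in [A :\ x] are adjacent to
[x], and the others have the same degree in [A].  With [x] this gives two
vertices, whence the bound on [k].  For [k = 3] the complete graph on four vertices minus an edge is
a counterexample. *)
Lemma small_degree_count k A : k <= 2 -> degenerate k A -> k <= #|A| ->
  k <= #|[set x in A | degree_in A x < k]|.
Proof.
move=> lek2; have [n] := ubnP #|A|; elim: n A => // n IHn A leAn dA.
rewrite leq_eqVlt => /predU1P[kA | ltkA].
  rewrite {1}kA; apply/subset_leq_card/subsetP=> x xA.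
  by rewrite inE xA kA degree_in_lt_card.
have nzA : A != set0 by rewrite -card_gt0 (leq_ltn_trans _ ltkA).
have [x xA dx] := degenerateP _ _ dA A (subxx A) nzA.
have cA : #|A| = #|A :\ x|.+1 by rewrite (cardsD1 x) xA.
set L := [set y in A | _].
set L' := [set y in A :\ x | degree_in (A :\ x) y < k].
have leL' : k <= #|L'|.
  apply: IHn; rewrite -1?ltnS -?cA //; exact: degenerateS (subsetDl _ _) dA.
have sL : x |: L' :\: [set y in A | x -- y] \subset L.
  apply/subsetP=> y; rewrite !inE => /predU1P[-> | /andP[nxy]].
    by rewrite xA dx.
  case/andP=> /andP[_ yA]; move: nxy; rewrite yA /= => nxy.
  by rewrite (degree_inD1 _ xA) sedge_sym (negbTE nxy).
apply: leq_trans (subset_leq_card sL).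
rewrite cardsU1 !inE eqxx andbF /= (leq_trans lek2) // add1n ltnS.
rewrite cardsD subn_gt0; apply: leq_trans leL'.
by apply: leq_ltn_trans dx; apply/subset_leq_card/subsetIr.
Qed.

End Degrees.

(** * Deleting the ends of an edge *)

Section Induced.
Variables (G : sgraph) (A : {set G}).

Lemma card_induced : #|induced A| = #|A|.
Proof. by rewrite card_sig; apply: eq_card => x; rewrite inE. Qed.

Lemma degree_in_induced (B : {set G}) (u : induced A) : B \subset A ->
  degree_in [set w : induced A | val w \in B] u = degree_in B (val u).
Proof.
move=> sBA; rewrite /degree_in -(card_imset _ val_inj); apply: eq_card => y.
rewrite !inE; apply/imsetP/andP=> [[w] | [yB uy]].
  by rewrite !inE => /andP[wB uw] ->.
by exists (Sub y (subsetP sBA y yB)); rewrite ?inE ?yB.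
Qed.

Lemma col_induced k : col (induced A) <= k -> degenerate k A.
Proof.
rewrite col_leE => /degenerateP dA; apply/degenerateP=> B sBA /set0Pn[x xB].
have [||u] := dA [set w : induced A | val w \in B]; first exact: subsetT.
  by apply/set0Pn; exists (Sub x (subsetP sBA x xB)); rewrite inE.
by rewrite inE (degree_in_induced _ sBA); exists (val u).
Qed.

End Induced.

Lemma card_del_ends (G : sgraph) (x y : G) :
  x != y -> #|del_ends x y| + 2 = #|G|.
Proof. by move=> xy; rewrite card_induced -(cardsC [set x; y]) cards2 xy addnC. Qed.

(** * Double-critical graphs *)

Section DoubleCritical.
Variable G : sgraph.
Hypothesis critG : double_col_critical G.
Implicit Types (A B : {set G}) (x y : G).

Lemma crit_degenerate x y : x -- y -> degenerate (col G - 2) (~: [set x; y]).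
Proof.
move=> /critG.2 cxy; apply: col_induced; rewrite -(leq_add2r 2) subnK //.
by apply: leq_trans cxy; rewrite leq_addl.
Qed.

(** An edge [w -- v] leaving [A] at [w] cannot be double-critical: deleting its
ends keeps [A :\ w], where all degrees are still at least [col G - 2].  The case [A = [set w]] is apart: degree zero would
force [col G <= 1], but an edge with this property needs [2 <= col G]. *)
Lemma full_core A : A != set0 ->
  {in A, forall x, col G <= (degree_in A x).+1} -> A = [set: G].
Proof.
move=> /set0Pn[a aA] dA; apply/eqP; rewrite eqEsubset subsetT /=.
apply: contraT => /subsetPn[b _ bA].
have [/existsP[w /existsP[v /and3P[wA vA wv]]] | noedge] :=
  boolP [exists w, exists v, [&& w \in A, v \notin A & w -- v]]; last first.
  have clA : closed (@sedge G) (mem A).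
    apply: intro_closed; first exact/sym_connect_sym/sedge_sym.
    move=> x y xy xA; apply: contraR noedge => yA.
    by apply/existsP; exists x; apply/existsP; exists y; rewrite xA yA.
  by have := closed_connect clA (critG.1 a b); rewrite /= aA (negbTE bA).
have le2 : 2 <= col G by apply: leq_trans (critG.2 _ _ wv); rewrite leq_addl.
have sA : A :\ w \subset ~: [set w; v].
  apply/subsetP=> y; rewrite !inE negb_or => /andP[-> yA] /=.
  by apply: contraNneq vA => <-.
have [A0 | nzA] := eqVneq (A :\ w) set0.
  have := leq_trans le2 (dA w wA).
  rewrite (degree_inD1 _ wA) sedge_irrefl A0 ltnS => /card_gt0P[y].
  by rewrite !inE.
have [x xA] := degenerateP _ _ (crit_degenerate wv) _ sA nzA.
rewrite ltn_subRL => dx.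
have /(dA x) : x \in A by case/setD1P: xA.
rewrite (degree_inD1 _ wA) leqNgt => /negP[]; apply: leq_ltn_trans dx.
by rewrite add2n !ltnS -[_.+1]add1n leq_add2r leq_b1.
Qed.

(** A set witnessing that [col G] is not smaller is all of [G]. *)
Lemma min_degree x : col G <= (degree_in [set: G] x).+1.
Proof.
case def_k : (col G) => [//|k].
have: ~~ (col G <= k) by rewrite def_k ltnn.
rewrite col_leE => /forallPn[A]; rewrite negb_imply => /andP[/andP[_ nzA]].
rewrite negb_exists_in => /forall_inP dA.
have AT : A = [set: G].
  by apply: full_core => // y /dA; rewrite def_k -leqNgt ltnS.
by have := dA x; rewrite AT inE -leqNgt ltnS; apply.
Qed.

(** A vertex with fewer than [col G - 2] neighbours outside [x] and [y] reaches
the minimum degree only if it is adjacent to both. *)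
Lemma common_neighbours x y : col G <= 4 -> x -- y ->
  col G - 2 <= #|[set z | (x -- z) && (y -- z)]|.
Proof.
move=> le4 xy; set A := ~: [set x; y].
have dA : col G - 2 <= #|A|.
  have c2 : #|[set x; y]| = 2 by rewrite cards2 sedge_neq.
  by rewrite leq_subLR -[X in X + _]c2 cardsC col_le_card.
have AE : A = [set: G] :\ x :\ y.
  by apply/setP=> z; rewrite !inE negb_or andbT andbC.
have le2 : col G - 2 <= 2 by rewrite leq_subLR.
apply: leq_trans (small_degree_count le2 (crit_degenerate xy) dA) _.
apply/subset_leq_card/subsetP=> z; rewrite inE => /andP[_].
rewrite -/A ltn_subRL => /leq_trans/(_ (min_degree z)).
have yT : y \in [set: G] :\ x by rewrite !inE eq_sym sedge_neq.
rewrite (degree_inD1 z (in_setT x)) (degree_inD1 z yT) -AE inE.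
rewrite ![z -- _]sedge_sym ltnS addnA leq_add2r.
by case: (x -- z); case: (y -- z).
Qed.

(** A vertex [a] of degree below [col G] and its neighbours form a complete graph,
to which [full_core] applies. *)
Lemma crit_complete x y : col G <= 4 ->
  #|G| = col G /\ (x -- y) = (x != y).
Proof.
move=> le4.
have [a _ da] : exists2 a, a \in [set: G] & degree_in [set: G] a < col G.
  by apply: degenerateP (subxx _) _; rewrite -?col_leE //; apply/set0Pn; exists x.
set N := [set b in [set: G] | a -- b].
have aN : a \notin N by rewrite !inE sedge_irrefl.
have Nclique : {in N &, forall b c, c != b -> b -- c}.
  move=> b c bN cN cb; have ab : a -- b by rewrite !inE in bN.
  (* [N :\ b] has at most [col G - 2] elements, so the common neighbours of [a]
     and [b] fill it. *)
  have sCN : [set z | (a -- z) && (b -- z)] \subset N :\ b.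
    apply/subsetP=> z; rewrite !inE => /andP[-> /sedge_neq].
    by rewrite eq_sym => ->.
  have /eqP CN : [set z | (a -- z) && (b -- z)] == N :\ b.
    rewrite eqEcard sCN (leq_trans _ (common_neighbours le4 ab)) //.
    move: da; rewrite -[degree_in _ a]/#|N| (cardsD1 b N) bN => da.
    by rewrite leq_subRL ?(leq_trans _ da).
  have : c \in N :\ b by rewrite in_setD1 cb.
  by rewrite -CN inE => /andP[].
have Kclique : {in a |: N &, forall b c, c != b -> b -- c}.
  move=> b c /setU1P[-> | bN] /setU1P[-> | cN]; last exact: Nclique.
  - by rewrite eqxx.
  - by rewrite !inE in cN.
  - by rewrite !inE sedge_sym in bN.
have cK : #|a |: N| = (degree_in [set: G] a).+1 by rewrite cardsU1 aN.
have KT : a |: N = [set: G].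
  apply: full_core => [|b bK]; first by apply/set0Pn; exists a; rewrite setU11.
  rewrite degree_in_complete // => [|c cK' cb]; last exact: Kclique.
  by rewrite cK min_degree.
split.
  by apply/eqP; rewrite eqn_leq col_le_card andbT -cardsT -KT cK.
apply/idP/idP=> [/sedge_neq // | xy].
by apply: Kclique; rewrite ?KT ?inE // eq_sym.
Qed.

End DoubleCritical.

(** * Complete graphs *)

Lemma iso_completeP k (G : sgraph) :
  sgraph_iso G (complete_graph k) <->
  #|G| = k /\ forall x y : G, (x -- y) = (x != y).
Proof.
split=> [[f bij_f fE] | [<- GE]].
  split=> [|x y]; first by rewrite (bij_eq_card bij_f) card_ord.
  by rewrite -fE -(inj_eq (bij_inj bij_f)).
exists enum_rank => [|x y]; first exact: enum_rank_bij.
by rewrite GE -(inj_eq enum_rank_inj).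
Qed.

Lemma col_complete (G : sgraph) :
  (forall x y : G, (x -- y) = (x != y)) -> col G = #|G|.
Proof.
move=> GE; apply/eqP; rewrite eqn_leq col_le_card /= leqNgt.
apply/negP=> ltG.
have [||x _] := @degenerateP G (col G) setT _ setT (subxx _).
- by rewrite -col_leE.
- by rewrite -card_gt0 cardsT (leq_ltn_trans _ ltG).
rewrite -ltnS degree_in_complete ?inE // => [|y _].
  by rewrite cardsT ltnS leqNgt ltG.
by rewrite GE eq_sym.
Qed.

(** Deleting the ends of an edge leaves [#|G| - 2] vertices, and the number of
vertices bounds the colouring number. *)
Lemma complete_crit (G : sgraph) :
  (forall x y : G, (x -- y) = (x != y)) -> double_col_critical G.
Proof.
move=> GE; split=> [x y | x y xy].
  by have [-> // | xy] := eqVneq x y; apply: connect1; rewrite GE.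
rewrite /double_col_critical_edge (col_complete GE).
by rewrite -(card_del_ends (sedge_neq xy)) leq_add2r col_le_card.
Qed.

Theorem mainTheorem2 (k : nat) (hk : k <= 4) (G : sgraph) :
  (double_col_critical G /\ col G = k) <-> sgraph_iso G (complete_graph k).
Proof.
split=> [[critG colG] | /iso_completeP[<- GE]]; last first.
  by split; [apply: complete_crit | apply: col_complete].
apply/iso_completeP; split=> [|x y].
  2: by have [] := crit_complete critG x y; rewrite ?colG.
have [G0 | /card_gt0P[x _]] := posnP #|G|.
  by have := col_le_card G; rewrite colG G0 leqn0 => /eqP.
by have [|//] := crit_complete critG x x; rewrite colG.
Qed.
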